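(* For every integer $t\geq 4$, every graph $G$ that does not contain $K_t$ as a minor has a connected partition $H_1,\dots,H_\ell$ such that for every $i\in\{1,\dots,\ell\}$: (1) $H_i$ is adjacent to at most $t-2$ of the subgraphs $H_1,\dots,H_{i-1}$; (2) $H_i$ has maximum degree at most $t-2$; and (3) $H_i$ is $2$-colourable with clustering $\lceil \tfrac12(t-2)\rceil$.
   Context: All graphs are finite and simple. A sequence $H_1,\dots,H_\ell$ is a connected partition of $G$ if each $H_i$ is a non-empty connected induced subgraph of $G$, the $H_i$ are pairwise vertex-disjoint, and $V(G)=V(H_1)\cup\dots\cup V(H_\ell)$. Two disjoint subgraphs $H,H'$ of $G$ are adjacent if some edge of $G$ has one endpoint in $H$ and the other in $H'$. A graph is $k$-colourable with clustering $c$ if its vertices can be assigned one of $k$ colours (not necessarily properly) so that every connected component of the subgraph induced by one colour class has at most $c$ vertices. *)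

(* Defs.v *)
From mathcomp Require Import all_boot.

Set Implicit Arguments.
Unset Strict Implicit.
Unset Printing Implicit Defensive.

(* Finite simple graphs; the null graph (no vertices) is allowed. *)
Record sgraph := SGraph {
  vertex :> finType;
  edge : rel vertex;
  edge_sym : symmetric edge;
  edge_irrefl : irreflexive edge
}.
Arguments edge {s}.

Section Complete.
Variable n : nat.

Definition complete_edge : rel 'I_n := fun i j => i != j.

Lemma complete_edge_sym : symmetric complete_edge.
Proof. by move=> i j; rewrite /complete_edge eq_sym. Qed.

Lemma complete_edge_irrefl : irreflexive complete_edge.
Proof. by move=> i; rewrite /complete_edge eqxx. Qed.

Definition complete : sgraph := SGraph complete_edge_sym complete_edge_irrefl.
End Complete.

Section Induced.
Variables (G : sgraph) (S : {set G}).

Definition induced_edge : rel {x : G | x \in S} :=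
  fun x y => edge (val x) (val y).

Lemma induced_edge_sym : symmetric induced_edge.
Proof. by move=> x y; apply: edge_sym. Qed.

Lemma induced_edge_irrefl : irreflexive induced_edge.
Proof. by move=> x; apply: edge_irrefl. Qed.

Definition induced : sgraph := SGraph induced_edge_sym induced_edge_irrefl.
End Induced.

(* Holds of the null graph; non-emptiness is always required separately. *)
Definition connected (G : sgraph) : Prop := forall x y : G, connect edge x y.

Definition components (G : sgraph) : {set {set G}} :=
  equivalence_partition (connect edge) [set: G].

Definition max_degree (G : sgraph) : nat :=
  \max_(v : G) #|[set w : G | edge v w]|.

Definition adjacent (G : sgraph) (A B : {set G}) : bool :=
  [exists x in A, exists y in B, edge x y].

(* H is obtained from a subgraph of G by contracting each branch set B x to
   the vertex x. *)
Definition is_minor (H G : sgraph) : Prop :=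
  exists B : H -> {set G},
    [/\ forall x, B x != set0,
        forall x, connected (induced (B x)),
        forall x y, x != y -> [disjoint B x & B y]
      & forall x y, edge x y -> adjacent (B x) (B y)].

(* An induced subgraph is represented by its vertex set. *)
Definition connected_partition (G : sgraph) (l : nat) (H : 'I_l -> {set G}) :
    Prop :=
  [/\ forall i, H i != set0,
      forall i, connected (induced (H i)),
      forall i j, i != j -> [disjoint H i & H j]
    & \bigcup_i H i = [set: G]].

(* The colouring f need not be proper. *)
Definition colourable_with_clustering (G : sgraph) (k c : nat) : Prop :=
  exists f : G -> 'I_k, forall (a : 'I_k) (C : {set induced [set v | f v == a]}),
    C \in components (induced [set v | f v == a]) -> #|C| <= c.

(* Main.v *)
Require Import Defs.
From mathcomp Require Import all_boot zify.

Set Implicit Arguments.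
Unset Strict Implicit.
Unset Printing Implicit Defensive.

(* Build the parts greedily, keeping the invariant that the parts adjacent to any
   connected set of uncovered vertices are pairwise adjacent.  A component C of
   the uncovered vertices is then adjacent to at most t-2 parts, since C and t-1
   such parts would be the branch sets of a K_t minor.  The next part is a
   minimal connected set A inside C containing a set S of neighbours of those
   parts, with |S| <= t-2.

   By minimality every u in A \ S is a cut vertex of A.  Cutting A at u gives two
   sets minimal for S restricted to each side plus u, so the degree bound and the
   2-colouring follow by induction, down to A = S, where one colours half of S. *)

(** * Connectedness of vertex subsets through cuts *)

Section ConnectedSets.
Variable G : sgraph.
Implicit Types (A B C S X Y : {set G}) (u v x y : G).

Lemma adjacentP A B :
  reflect (exists x y, [/\ x \in A, y \in B & edge x y]) (adjacent A B).
Proof.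
apply: (iffP existsP) => [[x /andP[xA /existsP[y /andP[yB e]]]]|[x [y [xA yB e]]]].
  by exists x, y.
by exists x; rewrite xA; apply/existsP; exists y; rewrite yB.
Qed.

Lemma adjacent_sym A B : adjacent A B = adjacent B A.
Proof.
by apply/adjacentP/adjacentP => -[x [y [xA yB e]]]; exists y, x; split=> //; rewrite edge_sym.
Qed.

Lemma adjacentSl A B C : A \subset B -> adjacent A C -> adjacent B C.
Proof.
move=> /subsetP sAB /adjacentP[x [y [xA yC e]]]; apply/adjacentP.
by exists x, y; split=> //; apply: sAB.
Qed.

(** Connectedness by cuts, stated inside [G] rather than in an induced graph. Being boolean, it can
    serve in [minset] and [maxset] searches. The empty set satisfies it. *)
Definition conn X :=
  [forall Y : {set G}, (Y != set0) && (Y \proper X) ==> adjacent Y (X :\: Y)].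

Lemma connP X :
  reflect (forall Y, Y != set0 -> Y \proper X ->
             exists x y, [/\ x \in Y, y \in X, y \notin Y & edge x y])
          (conn X).
Proof.
apply: (iffP forallP) => [cX Y Y0 YX | cX Y].
  have /adjacentP[x [y [xY]]] : adjacent Y (X :\: Y).
    by apply: (implyP (cX Y)); rewrite Y0.
  by rewrite inE => /andP[yY yX] e; exists x, y.
apply/implyP=> /andP[Y0 YX]; have [x [y [xY yX yY e]]] := cX Y Y0 YX.
by apply/adjacentP; exists x, y; rewrite inE yY.
Qed.

(** Only cuts on the side of [u] need checking: a crossing edge for [X :\: Y], read backwards, is
    one for [Y]. *)
Lemma conn_rooted X u : u \in X ->
  (forall Y, u \in Y -> Y \proper X ->
     exists x y, [/\ x \in Y, y \in X, y \notin Y & edge x y]) -> conn X.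
Proof.
move=> uX cX; apply/connP => Y Y0 YX; have [uY | uY] := boolP (u \in Y).
  exact: cX.
have sYX := proper_sub YX.
have [||x [y []]] := cX (X :\: Y); first by rewrite inE uY.
  rewrite properE subsetDl /=; apply/negP => sX.
  have [z zY] := set0Pn _ Y0.
  by have := subsetP sX z (subsetP sYX z zY); rewrite inE zY.
rewrite !inE => /andP[xY xX] yX; rewrite yX andbT negbK => yY e.
by exists y, x; split=> //; rewrite edge_sym.
Qed.

Lemma conn1 u : conn [set u].
Proof.
apply: (@conn_rooted _ u) => [|Y uY]; first by rewrite inE.
by rewrite properE sub1set uY andbF.
Qed.

Lemma connU X Y u : u \in X -> u \in Y -> conn X -> conn Y -> conn (X :|: Y).
Proof.
move=> uX uY cX cY; apply: (@conn_rooted _ u) => [|Z uZ ZXY].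
  by rewrite inE uX.
have half (W : {set G}) : u \in W -> conn W -> ~~ (W \subset Z) ->
    exists x y, [/\ x \in Z, y \in W, y \notin Z & edge x y].
  move=> uW /connP cW WZ; have [||x [y [xZ yW yZ e]]] := cW (Z :&: W).
  - by apply/set0Pn; exists u; rewrite inE uZ.
  - by rewrite properE subsetIr subsetI negb_and WZ.
  exists x, y; move: xZ yZ; rewrite !inE yW andbT => /andP[-> _] yZ.
  by split.
have : ~~ (X \subset Z) || ~~ (Y \subset Z).
  by rewrite -negb_and -subUset; case/andP: ZXY.
by case/orP => /half[//|//|x [y [xZ yW yZ e]]]; exists x, y; rewrite inE yW ?orbT.
Qed.

Lemma conn2 x y : edge x y -> conn [set x; y].
Proof.
move=> e; apply: (@conn_rooted _ x) => [|Y xY YX]; first by rewrite !inE eqxx.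
exists x, y; split=> //; first by rewrite !inE eqxx orbT.
by apply: contraL YX => yY; rewrite properE subUset !sub1set xY yY andbF.
Qed.

Lemma connU_adjacent X Y : adjacent X Y -> conn X -> conn Y -> conn (X :|: Y).
Proof.
move=> /adjacentP[x [y [xX yY e]]] cX cY.
have -> : X :|: Y = X :|: ([set x; y] :|: Y).
  by apply/setP=> z; rewrite !inE; case: eqP => [->|_]; case: eqP => [->|_];
    rewrite ?xX ?yY ?orbT.
apply: (@connU _ _ x) => //; first by rewrite !inE eqxx.
by apply: (@connU _ _ y) => //; [rewrite !inE eqxx orbT | apply: conn2].
Qed.

(** Within [X], the set [A] can be entered only at [u]. Enlarge a cut [Y] containing [u] by all of
    [X :\: A]: the edge leaving the enlarged cut ends in [A] outside [Y], hence not at [u], so it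
    must start in [Y]. *)
Lemma connI_gate X A u : conn X -> u \in X -> u \in A ->
  (forall x y, x \notin A -> y \in A -> edge x y -> x \in X -> y \in X -> y = u) ->
  conn (X :&: A).
Proof.
move=> /connP cX uX uA gate; apply: (@conn_rooted _ u) => [|Y uY YXA].
  by rewrite inE uX.
have [sY [z]] := properP YXA; rewrite inE => /andP[zX zA] zY.
have [||x [y []]] := cX (Y :|: (X :\: A)).
- by apply/set0Pn; exists u; rewrite inE uY.
- apply/properP; split; last by exists z; rewrite ?inE ?(negPf zY) ?zA.
  by rewrite subUset subsetDl (subset_trans sY) ?subsetIl.
rewrite !inE => xP yX; rewrite yX andbT negb_or negbK => /andP[yY yA] e.
case/orP: xP => [xY|/andP[xA xX]]; first by exists x, y; rewrite inE yX.
by move: yY; rewrite (gate x y) // uY.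
Qed.

Lemma conn_connected X : conn X -> connected (induced X).
Proof.
move=> /connP cX x y; apply/negPn/negP => nxy.
(* The cut is the set of vertices reachable from [x]; an edge leaving it would reach one more
   vertex. *)
have [||a [z [/imsetP[w + ->]]]] := cX (val @: [set w | connect edge x w]).
- by apply/set0Pn; exists (val x); apply/imset_f; rewrite inE connect0.
- apply/properP; split; first by apply/subsetP=> _ /imsetP[w _ ->]; apply: valP.
  exists (val y); first exact: valP.
  by rewrite mem_imset ?inE //; apply: val_inj.
rewrite inE => xw zX zC e; case/negP: zC.
apply/imsetP; exists (Sub z zX) => //; rewrite inE.
exact: connect_trans xw (connect1 _).
Qed.

Lemma component_conn X : X \in components G -> conn X.
Proof.
have eqv : {in [set: G] & &, equivalence_rel (@connect G edge)}.
  move=> x y z _ _ _; split=> [|xy]; first exact: connect0.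
  exact: same_connect (sym_connect_sym (@edge_sym G)) _ _ xy _.
case/imsetP => c _ ->; apply/forallP => Y; apply/implyP => /andP[Y0 /properP[sY [z zC zY]]].
have cz : connect edge c z by move: zC; rewrite !inE.
have [y yY] := set0Pn _ Y0.
have cy : connect edge c y by have := subsetP sY y yY; rewrite !inE.
apply: contraT => /adjacentP noedge; case/negP: zY.
have clY : closed edge (mem Y).
  apply: (intro_closed (sym_connect_sym (@edge_sym G))) => a b eab aY.
  apply/negPn/negP => bY; case: noedge; exists a, b.
  have ca : connect edge c a by have := subsetP sY a aY; rewrite !inE.
  rewrite !inE bY; split=> //; apply: connect_trans ca _; exact: connect1.
rewrite -[z \in Y](closed_connect clY (x := y)) //.
by apply: connect_trans cz; rewrite (sym_connect_sym (@edge_sym G)).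
Qed.

End ConnectedSets.

Lemma conn_val (G : sgraph) (S : {set G}) (X : {set induced S}) :
  conn X -> conn (val @: X).
Proof.
move=> /connP cX; apply/connP => Y Y0 /properP[sY [z /imsetP[w wX ->] wY]].
have [||x [y]] := cX (val @^-1: Y).
- have [y yY] := set0Pn _ Y0; have /imsetP[b _ yb] := subsetP sY y yY.
  by apply/set0Pn; exists b; rewrite inE -yb.
- apply/properP; split; last by exists w; rewrite ?inE.
  apply/subsetP=> b; rewrite inE => /(subsetP sY).
  by rewrite mem_imset //; apply: val_inj.
rewrite !inE => -[xY yX yY e]; exists (val x), (val y); split=> //.
exact: imset_f.
Qed.

(** * Minimal connected sets and their splitting at cut vertices *)

Section Tight.
Variable G : sgraph.
Implicit Types (A B C S X Y : {set G}) (u v x y : G).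

Definition tight A S :=
  [/\ conn A, S \subset A & forall B, S \subset B -> B \proper A -> ~~ conn B].

Lemma tight_exists C S : conn C -> S \subset C -> exists2 A : {set G}, A \subset C & tight A S.
Proof.
move=> cC sSC; pose P (A : {set G}) := conn A && (S \subset A).
have [|A /minsetP[/andP[cA sSA] minA] sAC] := @minset_exists _ P C.
  by rewrite /P cC.
exists A => //; split=> // B sSB /andP[sBA]; apply: contraNN => cB.
by rewrite -(minA B) // /P cB.
Qed.

(** A separation of order one: two proper sides that share just the cut vertex [u]. *)
Definition separation A u A1 A2 :=
  [/\ A1 :|: A2 = A, A1 :&: A2 = [set u], A1 \proper A, A2 \proper A
    & forall x y, x \in A1 -> y \in A2 -> edge x y -> x = u \/ y = u].

Lemma separationC A u A1 A2 : separation A u A1 A2 -> separation A u A2 A1.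
Proof.
case=> U I p1 p2 e; split=> //; rewrite 1?setUC 1?setIC // => x y xA yA.
by rewrite edge_sym => /(e _ _ yA xA) [];[right|left].
Qed.

Lemma separation_exists A u : u \in A -> conn A -> ~~ conn (A :\ u) ->
  exists A1 A2, separation A u A1 A2.
Proof.
move=> uA /connP cA; rewrite negb_forall => /existsP[Y].
rewrite negb_imply => /andP[/andP[Y0 /properP[sY [z zA zY]]] nadj].
have uY : u \notin Y by apply/negP=> /(subsetP sY); rewrite !inE eqxx.
have [y yY] := set0Pn _ Y0.
move: zA; rewrite !inE => /andP[zu zA].
(* [Y] has no edge to the rest of [A :\ u]; the cut vertex is put on both sides. *)
exists (u |: Y), (A :\: Y); split.
- apply/setP=> x; rewrite !inE; case: eqP => [->|/eqP xu] /=; first by rewrite uA.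
  case: (boolP (x \in Y)) => //= /(subsetP sY); by rewrite !inE => /andP[_ ->].
- apply/setP=> x; rewrite !inE; case: eqP => [->|_] /=; first by rewrite uY uA.
  by case: (x \in Y).
- apply/properP; split; last by exists z; rewrite ?inE ?negb_or ?zu.
  by rewrite subUset sub1set uA (subset_trans sY) ?subsetDl.
- apply/properP; split; first exact: subsetDl.
  exists y; last by rewrite inE yY.
  by have := subsetP sY y yY; rewrite !inE => /andP[].
move=> x w; rewrite !inE => /orP[/eqP->|xY]; first by left.
case/andP=> wY wA e; right; apply/eqP; apply: contraNT nadj => wu.
by apply/adjacentP; exists x, w; rewrite !inE wY wu.
Qed.

Lemma separation_conn X A u A1 A2 : separation A u A1 A2 ->
  X \subset A -> u \in X -> conn X -> conn (X :&: A1).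
Proof.
move=> [U I _ _ e] sXA uX cX.
have /setIP[u1 u2] : u \in A1 :&: A2 by rewrite I inE.
apply: (@connI_gate _ _ _ u) => // x y x1 y1 exy xX yX.
have := subsetP sXA x xX; rewrite -U inE (negPf x1) /= => x2.
case: (e y x y1 x2) => [|//|xu]; first by rewrite edge_sym.
by rewrite xu u1 in x1.
Qed.

(* A smaller connected set inside one half could be completed by the other half
   to a smaller connected set containing S. *)
Lemma separation_tight A S u A1 A2 : tight A S -> u \notin S ->
  separation A u A1 A2 -> tight A1 (u |: S :&: A1) /\ S :&: A1 != set0.
Proof.
move=> [cA sSA minA] uS sep; have [U I p1 p2 e] := sep.
have /setIP[u1 u2] : u \in A1 :&: A2 by rewrite I inE.
have uA : u \in A by rewrite -U inE u1.
have c1 : conn A1.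
  by rewrite -(setIidPr (proper_sub p1)); apply: separation_conn sep _ _ _.
have c2 : conn A2.
  rewrite -(setIidPr (proper_sub p2)).
  by apply: separation_conn (separationC sep) _ _ _.
split; last first.
  (* If the first side contained no terminal, the other side would be a smaller connected set
     containing [S]. *)
  apply/negP=> /eqP S1.
  suff sS2 : S \subset A2 by have := minA A2 sS2 p2; rewrite c2.
  apply/subsetP=> x xS; have := subsetP sSA x xS; rewrite -U inE.
  by case/orP => // x1; have := in_set0 x; rewrite -S1 inE xS x1.
split=> //; first by rewrite subUset sub1set u1 subsetIr.
move=> B; rewrite subUset sub1set => /andP[uB sB] /properP[sB1 [z z1 zB]].
apply/negP=> cB; suff : ~~ conn (B :|: A2).
  by rewrite (@connU _ _ _ u).
apply: minA.
- apply/subsetP=> x xS; have := subsetP sSA x xS; rewrite -U !inE.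
  case/orP=> [x1|->]; last by rewrite orbT.
  by rewrite (subsetP sB) // inE xS.
- apply/properP; split; first by rewrite -U setSU.
  exists z; first by rewrite -U inE z1.
  rewrite inE (negPf zB) /=; apply: contraNN zB => z2.
  have : z \in A1 :&: A2 by rewrite inE z1.
  by rewrite I inE => /eqP->.
Qed.

(** Inclusion-exclusion: the two traces of [X] overlap in [u] at most. *)
Lemma separation_card X A u A1 A2 : separation A u A1 A2 -> X \subset A ->
  #|X| + (u \in X) = #|X :&: A1| + #|X :&: A2|.
Proof.
move=> [U I _ _ _] sXA; rewrite -cardsUI -setIUr U (setIidPl sXA); congr (_ + _).
have -> : X :&: A1 :&: (X :&: A2) = X :&: [set u].
  by rewrite -I; apply/setP=> x; rewrite !inE; case: (x \in X).
case: (boolP (u \in X)) => uX.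
  by rewrite (setIidPr _) ?cards1 ?sub1set.
rewrite [_ :&: _](_ : _ = set0) ?cards0 //.
by apply/setP=> x; rewrite !inE; case: eqP => [->|]; rewrite ?andbF // (negPf uX).
Qed.

(** The inductive step shared by the degree bound and the colouring. Each side receives [u] as an
    additional terminal, but the opposite side keeps at least one terminal of [S], so neither side
    has more terminals than [S]. *)
Lemma tight_split A S : tight A S -> A != S ->
  exists u A1 A2,
    [/\ u \notin S, separation A u A1 A2 &
      (tight A1 (u |: S :&: A1) /\ tight A2 (u |: S :&: A2)) /\
      [/\ 0 < #|S :&: A1|, 0 < #|S :&: A2| & #|S| = #|S :&: A1| + #|S :&: A2|]].
Proof.
move=> tA nAS; have [cA sSA minA] := tA.
have /properP[_ [u uA uS]] : S \proper A by rewrite properEneq eq_sym nAS.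
have [|||A1 [A2 sep]] := @separation_exists A u => //.
  apply: minA; last exact: properD1.
  by apply/subsetP=> x xS; rewrite !inE (subsetP sSA) // andbT; apply: contraNneq uS => <-.
have [t1 S1] := separation_tight tA uS sep.
have [t2 S2] := separation_tight tA uS (separationC sep).
exists u, A1, A2; split=> //; split=> //; rewrite !card_gt0; split=> //.
by rewrite -(separation_card sep) // (negPf uS) addn0.
Qed.

End Tight.

(** Arithmetic of gluing two clusters at the cut vertex: [a] and [b] count the old terminals on the
    two sides, the successors include [u], and [z.+1 = x + y] because [u] lies in both clusters. *)
Lemma glued_uphalf a b x y z : 0 < b -> x <= uphalf a.+1 -> y <= b.+1./2 ->
  z.+1 = x + y -> z <= uphalf (a + b).
Proof. lia. Qed.

Lemma glued_half a b x y z : 0 < b -> x <= a.+1./2 -> y <= b.+1./2 ->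
  z.+1 = x + y -> z <= (a + b)./2.
Proof. lia. Qed.

(** * Degree bound and two-colouring of tight sets *)

Section TightHull.
Variable G : sgraph.
Implicit Types (A B C S X Y : {set G}) (u v x y : G) (f : G -> bool).

(** Leaving [x] out of the count is what lets the bounds add up: at the cut vertex [u] the two sides
    contribute only their old terminals, which total [#|S|]. Any other vertex has all its neighbours
    on its own side. *)
Lemma tight_degree A S x : tight A S -> x \in A ->
  #|[set w in A | edge x w]| <= #|S :\ x|.
Proof.
move: {2}#|A|.+1 (ltnSn #|A|) => n; elim: n A S x => // n IH A S x leAn tA xA.
have [-> | nAS] := eqVneq A S.
  apply/subset_leq_card/subsetP => w; rewrite !inE => /andP[-> e].
  by rewrite andbT; apply: contraTneq e => ->; rewrite edge_irrefl.
have [u [A1 [A2 [uS sep [[t1 t2] [S1 S2 SE]]]]]] := tight_split tA nAS.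
wlog x1 : A1 A2 sep t1 t2 S1 S2 SE / x \in A1.
  move=> wl; have [U _ _ _ _] := sep.
  have : x \in A1 :|: A2 by rewrite U.
  rewrite inE => /orP[] xi.
    exact: (wl A1 A2).
  by apply: (wl A2 A1) => //; [apply: separationC | rewrite addnC].
have [U I p1 p2 e] := sep; have lt1 := proper_card p1; have lt2 := proper_card p2.
have /setIP[u1 u2] : u \in A1 :&: A2 by rewrite I inE.
have le1 := IH _ _ x (leq_trans lt1 leAn) t1 x1.
have uSi B : u \notin S :&: B by rewrite inE (negPf uS).
have [xu | xu] := eqVneq x u.
  have x2 : x \in A2 by rewrite xu.
  have le2 := IH _ _ x (leq_trans lt2 leAn) t2 x2.
  have -> : S :\ x = S by apply/setDidPl; rewrite disjoint_sym disjoints1 xu.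
  move: le1 le2; rewrite xu !setU1K // SE => le1 le2.
  apply: leq_trans (leq_add le1 le2); apply: leq_trans (leq_card_setU _ _).
  apply/subset_leq_card/subsetP => w; rewrite -U !inE => /andP[+ ->].
  by rewrite !andbT.
have sN : [set w in A | edge x w] \subset [set w in A1 | edge x w].
  apply/subsetP => w; rewrite -U !inE => /andP[/orP[] wi exw]; rewrite exw andbT //.
  by case: (e _ _ x1 wi exw) => [/eqP|-> //]; rewrite (negPf xu).
apply: leq_trans (subset_leq_card sN) _; apply: leq_trans le1 _.
(* With [x] restored on both sides, it remains to compare [#|S :&: A1| + 1] with
   [#|S :&: A1| + #|S :&: A2|]: a terminal of the other side pays for [u]. *)
rewrite -(leq_add2l (x \in S)) -cardsD1 SE.
have -> : (x \in S) = (x \in u |: S :&: A1) by rewrite !inE (negPf xu) x1 andbT.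
by rewrite -cardsD1 cardsU1 uSi addnC leq_add2l.
Qed.

(* The sharper bound at the root v is what makes the induction close: gluing two
   halves at u merges their two clusters at u. *)
Lemma tight_rooted_colouring A S v : tight A S -> v \in S -> 1 < #|S| ->
  exists f, forall X, X \subset A -> conn X -> {in X &, forall x y, f x = f y} ->
    #|X| <= uphalf #|S| /\ (v \in X -> #|X| <= #|S|./2).
Proof.
move: {2}#|A|.+1 (ltnSn #|A|) => n; elim: n A S v => // n IH A S v leAn tA vS S_gt1.
have [-> | nAS] := eqVneq A S.
  (* One colour class is [B], the smaller half of [S], chosen to contain the root; the binomial
     coefficient is positive, so the remaining [#|S|./2.-1] vertices can be picked from [S :\ v]. *)
  have [B [vB sBS cB]] : exists B, [/\ v \in B, B \subset S & #|B| = #|S|./2].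
    have : 0 < 'C(#|S :\ v|, #|S|./2.-1).
      by rewrite bin_gt0; move: S_gt1; rewrite (cardsD1 v) vS; lia.
    rewrite -cards_draws card_gt0 => /set0Pn[B].
    rewrite inE subsetD1 => /andP[/andP[sBS vB] /eqP cB].
    exists (v |: B); rewrite setU11 subUset sub1set vS; split=> //.
    by rewrite cardsU1 vB cB; move: S_gt1; lia.
  exists (fun x => x \in B) => X sXS _ mono.
  have [sXB | /subsetPn[x xX xB]] := boolP (X \subset B).
    rewrite -cB; split=> [|_]; last exact: subset_leq_card.
    apply: leq_trans (subset_leq_card sXB) _.
    by rewrite cB uphalf_half leq_addl.
  split=> [|vX]; last by rewrite (mono x v) ?vB // in xB.
  have : X \subset S :\: B.
    by apply/subsetP=> y yX; rewrite inE (subsetP sXS) // andbT -(mono x y).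
  move/subset_leq_card/leq_trans; apply.
  by rewrite cardsD (setIidPr sBS) cB leq_subLR uphalf_half addnCA addnn
    odd_double_half.
have [u [A1 [A2 [uS sep [[t1 t2] [S1 S2 SE]]]]]] := tight_split tA nAS.
wlog v1 : A1 A2 sep t1 t2 S1 S2 SE / v \in A1.
  move=> wl; have [U _ _ _ _] := sep; have [_ sSA _] := tA.
  have : v \in A1 :|: A2 by rewrite U (subsetP sSA).
  rewrite inE => /orP[] vi.
    exact: (wl A1 A2).
  by apply: (wl A2 A1) => //; [apply: separationC | rewrite addnC].
have [U I p1 p2 e] := sep; have lt1 := proper_card p1; have lt2 := proper_card p2.
have /setIP[u1 u2] : u \in A1 :&: A2 by rewrite I inE.
have cS B : #|u |: S :&: B| = #|S :&: B|.+1.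
  by rewrite cardsU1 inE (negPf uS).
(* The first side keeps the root [v], while the second is rooted at [u], so that the cluster of [u]
   there obeys the sharper bound. *)
have [||f1 H1] := IH _ _ v (leq_trans lt1 leAn) t1.
- by rewrite !inE vS v1 orbT.
- by rewrite cS.
have [||f2 H2] := IH _ _ u (leq_trans lt2 leAn) t2.
- exact: setU11.
- by rewrite cS.
rewrite !cS in H1 H2.
(* The second colouring is flipped if necessary, so that both agree at [u]. *)
pose f x := if x \in A1 then f1 x else f2 x (+) f2 u (+) f1 u.
have fE2 x : x \in A2 -> f x = f2 x (+) f2 u (+) f1 u.
  rewrite /f; case: ifP => // x1 x2.
  have : x \in A1 :&: A2 by rewrite inE x1.
  by rewrite I inE => /eqP->; rewrite addbb.
exists f => X sXA cX mono.
have mono1 : {in X :&: A1 &, forall x y, f1 x = f1 y}.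
  move=> x y /setIP[xX x1] /setIP[yX y1].
  by have := mono x y xX yX; rewrite /f x1 y1.
have mono2 : {in X :&: A2 &, forall x y, f2 x = f2 y}.
  move=> x y /setIP[xX x2] /setIP[yX y2].
  by have := mono x y xX yX; rewrite !fE2 // => /addIb/addIb.
have [uX | uX] := boolP (u \in X).
  have [b1 b1v] := H1 _ (subsetIr _ _) (separation_conn sep sXA uX cX) mono1.
  have sep' := separationC sep.
  have [_ b2] := H2 _ (subsetIr _ _) (separation_conn sep' sXA uX cX) mono2.
  have {}b2 : #|X :&: A2| <= (#|S :&: A2|.+1)./2 by apply: b2; rewrite inE uX.
  have := separation_card sep sXA; rewrite uX addn1 => cXE.
  rewrite SE; split=> [|vX]; first exact: glued_uphalf S2 b1 b2 cXE.
  by apply: glued_half S2 _ b2 cXE; apply: b1v; rewrite inE vX.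
(* A cluster avoiding [u] lies on one side; that side has at most [#|S|] terminals, so its own bound
   suffices. *)
have lt1S : #|S :&: A1| < #|S| by rewrite SE -[ltnLHS]addn0 ltn_add2l.
have lt2S : #|S :&: A2| < #|S| by rewrite SE -[ltnLHS]add0n ltn_add2r.
have [sX1 | sX1] := boolP (X \subset A1).
  have := H1 X sX1 cX; rewrite -{1}(setIidPl sX1) => /(_ mono1)[b1 b1v].
  split=> [|vX]; first exact: leq_trans b1 (uphalf_leq _).
  exact: leq_trans (b1v vX) (half_leq _).
have sX2 : X \subset A2.
  apply/subsetP=> x xX; have := subsetP sXA x xX; rewrite -U inE => /orP[x1|//].
  (* Otherwise [X] meets both [A1] and its complement, and an edge of [X] across the separation
     would have to use [u]. *)
  have [||y [z []]] := connP _ cX (X :&: A1).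
  - by apply/set0Pn; exists x; rewrite inE xX.
  - by rewrite properE subsetIl subsetI subxx.
  rewrite !inE => /andP[yX y1] zX; rewrite zX /= => z1 exy.
  have z2 : z \in A2 by have := subsetP sXA z zX; rewrite -U inE (negPf z1).
  by case: (e _ _ y1 z2 exy) => xu; rewrite -xu ?yX ?zX in uX.
have := H2 X sX2 cX; rewrite -{1}(setIidPl sX2) => /(_ mono2)[b2 _].
split=> [|vX]; first exact: leq_trans b2 (uphalf_leq _).
(* The root cannot occur in this case: it would equal [u], which is not in [S]. *)
have : v \in A1 :&: A2 by rewrite inE v1 (subsetP sX2).
by rewrite I inE => /eqP vu; rewrite -vu vS in uS.
Qed.

Lemma tight_colouring A S : tight A S -> S != set0 ->
  exists f, forall X, X \subset A -> conn X -> {in X &, forall x y, f x = f y} ->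
    #|X| <= uphalf #|S|.
Proof.
move=> tA S0; have [S_gt1 | S_le1] := ltnP 1 #|S|.
  have [v vS] := set0Pn _ S0.
  have [f Hf] := tight_rooted_colouring tA vS S_gt1.
  by exists f => X sXA cX /(Hf X sXA cX)[].
have /cards1P[v Sv] : #|S| == 1 by rewrite eqn_leq S_le1 card_gt0.
(* With a single terminal, minimality forces [A] to be that one vertex, and any colouring works. *)
exists (fun=> true) => X sXA _ _; have [_ sSA minA] := tA.
have -> : #|S| = 1 by rewrite Sv cards1.
apply: leq_trans (subset_leq_card sXA) _.
have [-> | nAS] := eqVneq A S; first by rewrite Sv cards1.
have := minA S (subxx _); rewrite properEneq eq_sym nAS sSA => /(_ isT).
by rewrite Sv conn1.
Qed.

End TightHull.

(** * Greedy construction of the partition, with [k] standing for [t - 2] *)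

Section Parts.
Variables (G : sgraph) (k : nat).
Implicit Types (A C S X Y : {set G}) (s : seq {set G}).

Lemma tight_max_degree A S : tight A S -> #|S| <= k -> max_degree (induced A) <= k.
Proof.
move=> tA Sk; apply/bigmax_leqP => x _.
have := tight_degree tA (valP x).
move/leq_trans/(_ (leq_trans (subset_leq_card (subD1set _ _)) Sk)); apply: leq_trans.
rewrite -(card_imset _ val_inj); apply/subset_leq_card/subsetP => _ /imsetP[w + ->].
by rewrite !inE => xw; apply/andP; split; first exact: valP.
Qed.

Lemma tight_colourable A S : tight A S -> S != set0 -> #|S| <= k ->
  colourable_with_clustering (induced A) 2 (uphalf k).
Proof.
move=> tA S0 Sk; have [f Hf] := tight_colouring tA S0.
exists (fun x => if f (val x) then ord0 else ord_max) => a C cC.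
(* A cluster lives in a colour class of an induced subgraph, so two projections lead back to [G]. *)
have cVV : conn (val @: (val @: C)) by do 2!apply: conn_val; exact: component_conn.
rewrite -(card_imset _ val_inj) -(card_imset _ val_inj).
apply: leq_trans (uphalf_leq Sk); apply: Hf cVV _.
  by apply/subsetP => _ /imsetP[w _ ->]; apply: valP.
move=> _ _ /imsetP[_ /imsetP[x _ ->] ->] /imsetP[_ /imsetP[y _ ->] ->].
have := valP x; have := valP y; rewrite !inE => /eqP ya /eqP xa.
by have := etrans xa (esym ya); case: (f (val (val x)));
  case: (f (val (val y))) => // /(congr1 val).
Qed.

Lemma clique_minor n s : n <= size s ->
  {in s, forall X, X != set0 /\ conn X} ->
  pairwise (fun X Y => [disjoint X & Y]) s -> pairwise (@adjacent G) s ->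
  is_minor (complete n) G.
Proof.
move=> ns sP /(pairwiseP set0) dis /(pairwiseP set0) adj.
have lt (i : 'I_n) : i < size s by apply: leq_trans ns; apply: ltn_ord.
exists (fun i : 'I_n => nth set0 s i); split=> [i|i|i j|i j].
- by case: (sP _ (mem_nth set0 (lt i))).
- by apply: conn_connected; case: (sP _ (mem_nth set0 (lt i))).
- rewrite -val_eqE neq_ltn => /orP[] ij; first by apply: dis; rewrite ?inE ?lt.
  by rewrite disjoint_sym; apply: dis; rewrite ?inE ?lt.
rewrite /edge /= /complete_edge -val_eqE neq_ltn => /orP[] ij.
  by apply: adj; rewrite ?inE ?lt.
by rewrite adjacent_sym; apply: adj; rewrite ?inE ?lt.
Qed.

(** One endpoint in [C] is chosen for each member of [s]; repeated choices only make the set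
    smaller. *)
Lemma hitting_set C s : {in s, forall X, adjacent C X} ->
  exists S, [/\ S \subset C, #|S| <= size s & {in s, forall X, adjacent S X}].
Proof.
elim: s => [|X s IH] adj; first by exists set0; rewrite sub0set cards0.
have [|S [sSC leS hS]] := IH; first by move=> Y Ys; apply: adj; rewrite inE Ys orbT.
have /adjacentP[x [y [xC yX e]]] := adj X (mem_head _ _).
exists (x |: S); split; first by rewrite subUset sub1set xC.
  by rewrite cardsU1 /=; case: (x \in S) => //=; apply: leqW.
move=> Y; rewrite inE => /predU1P[->|/hS]; last exact/adjacentSl/subsetUr.
by apply/adjacentP; exists x, y; rewrite setU11.
Qed.

Definition uncovered s : {set G} := [set x | all (fun X => x \notin X) s].

Lemma uncovered_disjoint s A X : A \subset uncovered s -> X \in s -> [disjoint X & A].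
Proof.
move=> sA Xs; apply/pred0P => x /=; apply/negP => /andP[xX /(subsetP sA)].
by rewrite inE => /allP/(_ X Xs); rewrite xX.
Qed.

(** The last clause is the invariant of the greedy construction. It ranges over all connected
    uncovered sets, not just components, and therefore passes to smaller uncovered sets at once. *)
Definition partial_partition s :=
  [/\ pairwise (fun X Y => [disjoint X & Y]) s,
      {in s, forall X, [/\ X != set0, conn X, max_degree (induced X) <= k
               & colourable_with_clustering (induced X) 2 (uphalf k)]},
      forall i, i < size s -> count (adjacent (nth set0 s i)) (take i s) <= k
    & forall C, conn C -> C \subset uncovered s ->
        pairwise (@adjacent G) (filter (adjacent C) s)].

Hypothesis k_gt0 : 0 < k.
Hypothesis noKt : ~ is_minor (complete k.+2) G.

Lemma partial_partition_neighbours s C : partial_partition s ->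
  conn C -> C != set0 -> C \subset uncovered s -> count (adjacent C) s <= k.
Proof.
move=> [dis good _ adj] cC C0 sC; rewrite leqNgt; apply/negP => lt_k.
apply: noKt; apply: (@clique_minor _ (C :: filter (adjacent C) s)).
- by rewrite /= size_filter.
- move=> X; rewrite inE mem_filter => /predU1P[-> //|/andP[_ /good[]]] //.
- rewrite /= pairwise_filter // andbT; apply/allP => X.
  by rewrite mem_filter disjoint_sym => /andP[_]; apply: uncovered_disjoint.
- by rewrite /= filter_all adj.
Qed.

(** To keep the invariant, the new part [A] must be adjacent to every old part adjacent to a later
    set [D] that touches [A]. Such a [D] lies in the same component [C], so those old parts are
    neighbours of [C] and are hit by [S], which [A] contains. *)
Lemma partial_partition_extend s : partial_partition s -> uncovered s != set0 ->
  exists2 A, partial_partition (rcons s A) & uncovered (rcons s A) \proper uncovered s.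
Proof.
move=> pp /set0Pn[x xU]; have [dis good few adj] := pp.
(* [C] is the component of [x] among the uncovered vertices, obtained as a maximal connected set. *)
have [|C /maxsetP[/andP[cC sCU] maxC]] :=
  @maxset_exists _ (fun C => conn C && (C \subset uncovered s)) [set x].
  by rewrite conn1 sub1set.
rewrite sub1set => xC; have C0 : C != set0 by apply/set0Pn; exists x.
have few_C := partial_partition_neighbours pp cC C0 sCU.
have [|S0 [sS0 leS0 hS0]] := @hitting_set C (filter (adjacent C) s).
  by move=> X; rewrite mem_filter => /andP[].
have [S [sSC S_n0 leS hS]] : exists S, [/\ S \subset C, S != set0, #|S| <= k
    & {in filter (adjacent C) s, forall X, adjacent S X}].
  (* If the hitting set is empty, then no earlier part is adjacent to [C], and [[set x]] serves
     instead; its size is at most [k] because [0 < k]. *)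
  have [S00|] := eqVneq S0 set0; last first.
    by exists S0; split=> //; apply: leq_trans leS0 _; rewrite size_filter.
  exists [set x]; rewrite sub1set cards1 -card_gt0 cards1; split=> // X /hS0.
  by rewrite S00; apply/adjacentSl/sub0set.
have [A sAC tA] := tight_exists cC sSC; have [cA sSA _] := tA.
have sAU := subset_trans sAC sCU.
have uncE : uncovered (rcons s A) = uncovered s :\: A.
  by apply/setP=> y; rewrite !inE all_rcons.
have A0 : A != set0.
  by have [y yS] := set0Pn _ S_n0; apply/set0Pn; exists y; apply: (subsetP sSA).
exists A; last first.
  rewrite uncE properE subsetDl /=; have [y yA] := set0Pn _ A0.
  by apply/subsetPn; exists y; [apply: (subsetP sAU) | rewrite inE yA].
split.
- rewrite pairwise_rcons dis andbT; apply/allP=> X; exact: uncovered_disjoint.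
- move=> X; rewrite mem_rcons inE => /predU1P[->|/good //]; split=> //.
    exact: tight_max_degree tA leS.
  exact: tight_colourable tA S_n0 leS.
- move=> i; rewrite size_rcons ltnS leq_eqVlt => /predU1P[->|lt_i].
    rewrite nth_rcons ltnn eqxx -cats1 take_size_cat //.
    by apply: leq_trans few_C; apply: sub_count => X; apply: adjacentSl.
  by rewrite nth_rcons lt_i -cats1 takel_cat ?few // ltnW.
move=> D cD; rewrite uncE subsetD => /andP[sDU _].
rewrite filter_rcons; case: ifP => [adjDA|_]; last exact: adj.
rewrite pairwise_rcons adj // andbT; apply/allP=> X.
rewrite mem_filter => /andP[adjDX Xs].
(* [D :|: C] is connected and uncovered, so maximality of [C] absorbs [D]. *)
have sDC : D \subset C.
  rewrite -(maxC (D :|: C)) ?subsetUl ?subsetUr // subUset sDU sCU !andbT.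
  apply: connU_adjacent => //.
  by rewrite adjacent_sym; apply: adjacentSl sAC _; rewrite adjacent_sym.
rewrite adjacent_sym; apply: adjacentSl sSA _; apply: hS.
by rewrite mem_filter Xs (adjacentSl sDC adjDX).
Qed.

Lemma complete_partition_exists : exists2 s, partial_partition s & uncovered s = set0.
Proof.
suff ext n s : #|uncovered s| < n -> partial_partition s ->
    exists2 s', partial_partition s' & uncovered s' = set0.
  by apply: (ext _ [::] (ltnSn _)); split.
elim: n s => // n IH s lt_n pp; have [|/(partial_partition_extend pp)] := eqVneq (uncovered s) set0.
  by exists s.
by case=> A ppA /proper_card lt_A; apply: IH ppA; apply: leq_trans lt_A _.
Qed.

End Parts.

Theorem theorem3 (t : nat) (ht : 4 <= t) (G : sgraph)
    (hG : ~ is_minor (complete t) G) :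
  exists (l : nat) (H : 'I_l -> {set G}),
    connected_partition H /\
    forall i : 'I_l,
      [/\ #|[set j : 'I_l | (j < i) && adjacent (H i) (H j)]| <= t - 2,
          max_degree (induced (H i)) <= t - 2
        & colourable_with_clustering (induced (H i)) 2 (uphalf (t - 2))].
Proof.
have k_gt0 : 0 < t - 2 by rewrite subn_gt0 (leq_trans _ ht).
have tE : t = (t - 2).+2 by rewrite -addn2 subnK // (leq_trans _ ht).
move: (t - 2) tE k_gt0 => k tE k_gt0; rewrite tE in hG.
have [s [/(pairwiseP set0) dis good few _] cover] := complete_partition_exists k_gt0 hG.
exists (size s), (fun i => nth set0 s i); split.
  split=> [i|i|i j|].
  - by case: (good _ (mem_nth set0 (ltn_ord i))).
  - by apply: conn_connected; case: (good _ (mem_nth set0 (ltn_ord i))).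
  - rewrite -val_eqE neq_ltn => /orP[] ij; first by apply: dis; rewrite ?inE.
    by rewrite disjoint_sym; apply: dis; rewrite ?inE.
  apply/setP=> x; rewrite inE; apply/bigcupP.
  have : x \notin uncovered s by rewrite cover inE.
  rewrite inE -has_predC => /(has_nthP set0)[i lt_i]; rewrite /= negbK => xi.
  by exists (Ordinal lt_i).
move=> i; have [_ _ ? ?] := good _ (mem_nth set0 (ltn_ord i)); split=> //.
(* The set of earlier adjacent indices is turned into a count over the prefix [take i s]; the two
   numbers are equal. *)
apply: leq_trans (few i (ltn_ord i)); have lt_i := ltnW (ltn_ord i).
rewrite -sum1_card -sum1_count (big_nth set0) size_takel // big_mkord.
rewrite (big_ord_widen_cond (size s)
  (fun j => adjacent (nth set0 s i) (nth set0 (take i s) j)) (fun=> 1)) //.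
rewrite leq_eqVlt; apply/predU1P; left; apply: eq_bigl => j; rewrite inE andbC.
by case: ltnP => ji; rewrite ?andbF // nth_take.
Qed.
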